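(* Let $\mathcal{M}^I_m$ be a timelike first kind meridian surface of hyperbolic type in $\mathbb{R}^4_1$, parametrized by $z(u,v)=f(u)\,l(v)+g(u)\,e_1$, $u\in I$, $v\in J$. Then $\mathcal{M}^I_m$ has non-zero constant mean curvature, i.e. $\|H\|=a=\mathrm{const}$, $a\neq0$, if and only if the curve $l=l(v)$ on $\mathbb{S}^2_1(1)$ has constant non-zero spherical curvature $\varkappa=b=\mathrm{const}$, $b\neq0$, and the meridian curve $m:u\mapsto(f(u),g(u))$ is given by $\dot f=\varphi(f)$, where $$\varphi(t)=\pm\sqrt{1-\frac1{t^2}\left(c\mp\frac t2\sqrt{4a^2t^2-b^2}\pm\frac{b^2}{4a}\ln\left|2at+\sqrt{4a^2t^2-b^2}\right|\right)^2},\qquad c=\mathrm{const},$$ and the function $g(u)$ is defined by $\dot g=\pm\sqrt{1-\dot f^2}$.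
   Context: $\mathbb{R}^4_1$ is the Minkowski 4-space with metric $\langle\cdot,\cdot\rangle = dx_1^2+dx_2^2+dx_3^2-dx_4^2$ and standard orthonormal frame $e_1,e_2,e_3,e_4$ ($e_4$ timelike). $\mathbb{S}^2_1(1)=\{V\in\mathrm{span}\{e_2,e_3,e_4\}:\langle V,V\rangle=1\}$. A first kind meridian surface of hyperbolic type is the surface $z(u,v)=f(u)l(v)+g(u)e_1$, where $I,J\subset\mathbb{R}$ are intervals, $f,g:I\to\mathbb{R}$ are smooth with $f>0$, and $l:J\to\mathbb{S}^2_1(1)$ is a smooth timelike curve with $\langle l',l'\rangle=-1$ (prime $=d/dv$). The meridian curve is parametrized by arc length: $\dot f^2+\dot g^2=1$ (dot $=d/du$). The spherical curvature of $l$ is $\varkappa(v)=\langle t'(v),n(v)\rangle$, where $t=l'$ and $\{l,t,n\}$ is an orthonormal frame field of $\mathrm{span}\{e_2,e_3,e_4\}$ with $\langle n,n\rangle=1$ (so $t'=\varkappa n+l$, $n'=\varkappa t$). The mean curvature vector field is $H=\frac12(\sigma(x,x)-\sigma(y,y))$, with $\sigma$ the second fundamental form and $\{x,y\}$ an orthonormal tangent frame with $\langle x,x\rangle=1$, $\langle y,y\rangle=-1$; $\|H\|=\sqrt{\langle H,H\rangle}$ (the normal bundle is positive definite). In the formula for $\varphi$, the two inner signs $\mp,\pm$ are taken correspondingly (both upper or both lower), independently of the outer sign.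
   Formalization: Assumes ϰ is not identically zero and f is not constant (the claim fails otherwise); the equation for f, with one c and inner sign, is required on each interval where 4a²f² > b² (4a²f² ≥ b² on I), the outer sign may change at turning points, and I, J are open. *)

(* Defs.v *)
From mathcomp Require Import all_boot all_order all_algebra.
From mathcomp Require Import all_classical all_reals all_analysis.
Import Order.TTheory GRing.Theory Num.Theory numFieldNormedType.Exports.

Set Implicit Arguments.
Unset Strict Implicit.
Unset Printing Implicit Defensive.

Local Open Scope classical_set_scope.
Local Open Scope ring_scope.

Section Minkowski.
Variable R : realType.
Implicit Types (x y w : 'rV[R]_4).

(* Coordinates are numbered from 0: [frame_vec k] is e_(k+1), and the timelike
   direction e_4 is the index [ord_max]. *)
Definition frame_vec (k : 'I_4) : 'rV[R]_4 := delta_mx 0 k.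

Definition mdot x y : R :=
  \sum_(i < 4) (-1) ^+ (i == ord_max) * (x 0 i * y 0 i).

Definition mnorm x : R := Num.sqrt (mdot x x).

(* span {e_2, e_3, e_4} *)
Definition in_span234 w : Prop :=
  exists c2 c3 c4 : R,
    w = c2 *: frame_vec 1 + c3 *: frame_vec 2%:R + c4 *: frame_vec ord_max.

(* the de Sitter space S^2_1(1) *)
Definition deSitter : set 'rV[R]_4 :=
  [set w | in_span234 w /\ mdot w w = 1].

End Minkowski.

Section Calculus.
Variable R : realType.

Definition open_itv (I : set R) : Prop :=
  [/\ open I, is_interval I & I !=set0].

Definition smooth_on (V : normedModType R) (I : set R) (h : R -> V) : Prop :=
  forall (k : nat) (s : R), I s -> derivable (derive1n k h) s 1.

Definition d_u (V : normedModType R) (z : R -> R -> V) (u v : R) : V :=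
  derive1 (fun s => z s v) u.

Definition d_v (V : normedModType R) (z : R -> R -> V) (u v : R) : V :=
  derive1 (z u) v.

End Calculus.

Section TimelikeSurface.
Variables (R : realType) (z : R -> R -> 'rV[R]_4) (u v : R).
Implicit Types p q : R * R.

(* A tangent vector is given by its coordinates in the basis (z_u, z_v). *)
Definition tangent p : 'rV[R]_4 := p.1 *: d_u z u v + p.2 *: d_v z u v.

Definition orthonormal_frame p q : Prop :=
  [/\ mdot (tangent p) (tangent p) = 1,
      mdot (tangent q) (tangent q) = - 1
    & mdot (tangent p) (tangent q) = 0].

(* Flat derivative, along the tangent vector p, of the tangent field with
   constant coordinates q. *)
Definition flat_derivative p q : 'rV[R]_4 :=
  (p.1 * q.1) *: d_u (d_u z) u v + (p.1 * q.2) *: d_u (d_v z) u v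
  + (p.2 * q.1) *: d_v (d_u z) u v + (p.2 * q.2) *: d_v (d_v z) u v.

(* Normal component of w, where (x, y) is an orthonormal basis of the tangent
   plane with <x, x> = 1 and <y, y> = -1 (hence the sign in front of y). *)
Definition normal_part (x y w : 'rV[R]_4) : 'rV[R]_4 :=
  w - mdot w x *: x + mdot w y *: y.

(* H = (sigma(x, x) - sigma(y, y)) / 2, computed in the orthonormal frame
   x = tangent p, y = tangent q. *)
Definition mean_curvature_vector p q : 'rV[R]_4 :=
  let sigma r s :=
    normal_part (tangent p) (tangent q) (flat_derivative r s) in
  2^-1 *: (sigma p p - sigma q q).

End TimelikeSurface.

Section MeridianSurface.
Variable R : realType.

Definition mean_curvature_norm_is (I J : set R) (z : R -> R -> 'rV[R]_4)
    (a : R) : Prop :=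
  forall u v, I u -> J v -> forall p q, orthonormal_frame z u v p q ->
    mnorm (mean_curvature_vector z u v p q) = a.

Definition meridian_surface (f g : R -> R) (l : R -> 'rV[R]_4) (u v : R) :
    'rV[R]_4 :=
  f u *: l v + g u *: frame_vec R 0.

(* arc-length parametrized meridian curve *)
Definition meridian_curve (I : set R) (f g : R -> R) : Prop :=
  [/\ smooth_on I f, smooth_on I g, forall u, I u -> 0 < f u
    & forall u, I u -> derive1 f u ^+ 2 + derive1 g u ^+ 2 = 1].

(* unit-speed timelike curve on S^2_1(1) *)
Definition timelike_spherical_curve (J : set R) (l : R -> 'rV[R]_4) : Prop :=
  [/\ smooth_on J l, forall v, J v -> deSitter (l v)
    & forall v, J v -> mdot (derive1 l v) (derive1 l v) = - 1].

(* n completes l, l' to an orthonormal frame field of span {e_2, e_3, e_4} *)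
Definition spherical_normal (J : set R) (l n : R -> 'rV[R]_4) : Prop :=
  smooth_on J n /\
  forall v, J v ->
    [/\ in_span234 (n v), mdot (n v) (n v) = 1,
        mdot (n v) (l v) = 0 & mdot (n v) (derive1 l v) = 0].

Definition spherical_curvature (l n : R -> 'rV[R]_4) (v : R) : R :=
  mdot (derive1n 2 l v) (n v).

(* In phi the booleans are the signs: false is the upper sign, true the lower
   one; [inner] governs both inner signs, [outer] the sign of the root. *)
Definition phi_bracket (a b c : R) (inner : bool) (t : R) : R :=
  let w := Num.sqrt (4 * a ^+ 2 * t ^+ 2 - b ^+ 2) in
  c - (-1) ^+ inner * (t / 2 * w)
    + (-1) ^+ inner * (b ^+ 2 / (4 * a) * ln `|2 * a * t + w|).

Definition phi_radicand (a b c : R) (inner : bool) (t : R) : R :=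
  1 - (t ^+ 2)^-1 * phi_bracket a b c inner t ^+ 2.

Definition phi (a b c : R) (outer inner : bool) (t : R) : R :=
  (-1) ^+ outer * Num.sqrt (phi_radicand a b c inner t).

(* f' = phi(f) on K, with one constant c and one choice of the inner signs on
   all of K.  The outer sign is that of f', which changes when the meridian
   passes through a turning point.  [Num.sqrt] is 0 on negative numbers, hence
   the explicit condition on the radicand. *)
Definition solves_phi (K : set R) (a b : R) (f : R -> R) : Prop :=
  exists (c : R) (inner : bool), forall u, K u ->
    0 <= phi_radicand a b c inner (f u) /\
    exists outer : bool, derive1 f u = phi a b c outer inner (f u).

(* phi is real only where b^2 <= 4 a^2 t^2.  The two branches of the inner
   square root meet where 4 a^2 f^2 = b^2, and there a smooth meridian of
   constant mean curvature may pass from one choice of inner signs to the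
   other; so the equation is stated on the intervals where 4 a^2 f^2 > b^2
   (on all of I at once if this holds throughout I). *)
Definition meridian_given_by_phi (I : set R) (a b : R) (f : R -> R) : Prop :=
  (forall u, I u -> b ^+ 2 <= 4 * a ^+ 2 * f u ^+ 2) /\
  forall K : set R, K `<=` I -> is_interval K ->
    (forall u, K u -> b ^+ 2 < 4 * a ^+ 2 * f u ^+ 2) ->
    solves_phi K a b f.

Definition g_given_by_f (I : set R) (f g : R -> R) : Prop :=
  forall u, I u -> exists sg : bool,
    derive1 g u = (-1) ^+ sg * Num.sqrt (1 - derive1 f u ^+ 2).

End MeridianSurface.

(* Main.v *)
Require Import Defs.
From mathcomp Require Import all_boot all_order all_algebra.
From mathcomp Require Import all_classical all_reals all_analysis.
From mathcomp Require Import ring lra.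
Import Order.TTheory GRing.Theory Num.Theory numFieldNormedType.Exports.
Local Open Scope classical_set_scope.
Local Open Scope ring_scope.

(** The proof rests on one formula.  Let [k] be the spherical curvature and
    [W = f (f' g'' - g' f'') + g'] ([curvature_sum]).  For every orthonormal
    tangent frame, [4 f^2 <H, H> = k^2 + W^2]
    ([meridian_surface_mean_curvature]): the flat second derivatives that enter
    the trace are [f'' l + g'' e_1] and [f l''], Frenet's formula
    [l'' = l + k n] gives the Gram products, and an orthonormal frame may be
    replaced by [z_u, z_v] because the inverse of a Lorentz matrix is its
    transpose up to signs.  Hence [||H|| = a] means
    [k(v)^2 + W(u)^2 = 4 a^2 f(u)^2] for all [u] and [v].

    In this equation the variables separate.  [k^2] is constant, and [k], being
    continuous on an interval and nonzero somewhere, is a constant [b]; what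
    remains is [W^2 = 4 a^2 f^2 - b^2].  The identity [(f g')' = f' W]
    ([is_derive_meridian_moment]) integrates it.  Where the right-hand side is
    positive, [W] keeps one sign, so [f g'] is a primitive of
    [+- f' sqrt (4 a^2 f^2 - b^2)], that is, the bracket of [phi] evaluated at
    [f], for some [c]; and [f'^2 = 1 - g'^2] turns this into [f' = phi(f)].

    Conversely, [f' = phi(f)] says only that [(f g')^2] is the square of the
    bracket.  Functions with equal squares have derivatives with equal squares
    ([sqr_eq_is_derive]), so [f'^2 W^2 = f'^2 (4 a^2 f^2 - b^2)]; this proves
    the equation wherever [f' <> 0].  On an interval where [f' = 0] the
    differential equation does not determine [W], but there the defect
    [b^2 + W^2 - 4 a^2 f^2] is constant.  Its derivative therefore vanishes on
    a dense set, hence everywhere by continuity, and the defect is constant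
    on [I]; it is zero because [f] is not constant
    ([vanishes_off_stationary]). *)

Set Implicit Arguments.
Unset Strict Implicit.

(** * Real functions on intervals *)

Section Calculus.
Variable R : realType.
Implicit Types (F G h df dh : R -> R) (K : set R).

Lemma is_derive_mul F G (x dF dG : R) :
  is_derive x 1 F dF -> is_derive x 1 G dG ->
  is_derive x 1 (fun y => F y * G y) (dF * G x + F x * dG).
Proof.
move=> hF hG; apply: is_derive_eq (is_deriveM hF hG) _.
by rewrite /GRing.scale/= addrC mulrC.
Qed.

Lemma is_derive_sqr F (x dF : R) :
  is_derive x 1 F dF -> is_derive x 1 (fun y => F y ^+ 2) (2 * F x * dF).
Proof.
move=> hF; rewrite [X in is_derive _ _ X _](_ : _ = fun y => F y * F y)//.
by apply: is_derive_eq (is_derive_mul hF hF) _; ring.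
Qed.

Lemma is_derive_scale (k : R) (F : R -> R) (x dF : R) :
  is_derive x 1 F dF -> is_derive x 1 (fun y => k * F y) (k * dF).
Proof. by move=> hF; exact: is_deriveZ. Qed.

Lemma is_derive_const (k x : R) : is_derive x 1 (fun=> k : R) 0.
Proof. exact: is_derive_cst. Qed.

Lemma is_derive_add (F G : R -> R) (x dF dG : R) :
  is_derive x 1 F dF -> is_derive x 1 G dG ->
  is_derive x 1 (fun y => F y + G y) (dF + dG).
Proof. by move=> hF hG; exact: is_deriveD. Qed.

Lemma is_derive_sub (F G : R -> R) (x dF dG : R) :
  is_derive x 1 F dF -> is_derive x 1 G dG ->
  is_derive x 1 (fun y => F y - G y) (dF - dG).
Proof. by move=> hF hG; exact: is_deriveB. Qed.

Lemma is_derive_cvg F (x d : R) : is_derive x 1 F d -> {for x, continuous F}.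
Proof. by move=> [dF _]; exact/differentiable_continuous/derivable1_diffP. Qed.

Lemma near_open K x : open K -> K x -> \forall y \near x, K y.
Proof. by move=> oK Kx; exact: open_nbhs_nbhs. Qed.

Lemma interval_segment K x y z :
  is_interval K -> K x -> K y -> z \in `[x, y]%R -> K z.
Proof. by move=> iK Kx Ky; rewrite in_itv/=; exact: iK. Qed.

Lemma within_continuous_segment K F x y :
  is_interval K -> (forall z, K z -> {for z, continuous F}) -> K x -> K y ->
  {within `[x, y], continuous F}.
Proof.
move=> iK cF Kx Ky; apply/continuous_in_subspaceT => z /[1!inE] zxy.
exact: cF (interval_segment iK Kx Ky zxy).
Qed.

Lemma interval_derive0_eq K F : is_interval K ->
  (forall x, K x -> is_derive x 1 F 0) ->
  forall x y, K x -> K y -> F x = F y.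
Proof.
move=> iK dF x y; wlog xy : x y / x <= y => [W Kx Ky|Kx Ky].
  by case: (leP x y) => [|/ltW] xy; [|apply/esym]; exact: W.
have [z||z _] := @MVT_segment R F (fun=> 0) x y xy.
- move=> zxy; apply: dF; apply: (interval_segment iK Kx Ky).
  exact: subset_itv_oo_cc.
- apply: within_continuous_segment iK _ Kx Ky => z Kz.
  exact: is_derive_cvg (dF z Kz).
- by rewrite mul0r => /eqP; rewrite subr_eq0 => /eqP.
Qed.

(** By the intermediate value theorem; this fixes a single sign on [K] when only
    the square of a continuous function is known. *)
Lemma interval_nonzero_sign K F : is_interval K ->
  (forall x, K x -> {for x, continuous F}) -> (forall x, K x -> F x != 0) ->
  exists s : bool, forall x, K x -> F x = (-1) ^+ s * `|F x|.
Proof.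
move=> iK cF F0.
have pos x y : K x -> K y -> 0 < F x -> 0 < F y.
  move=> Kx Ky Fx; rewrite lt_neqAle eq_sym F0//= leNgt; apply/negP => Fy.
  have mM : Num.min (F x) (F y) <= 0 <= Num.max (F x) (F y).
    by rewrite ge_min le_max (ltW Fx) (ltW Fy) orbT.
  have [xy|/ltW yx] := leP x y.
    have [z /(interval_segment iK Kx Ky) Kz Fz] :=
      IVT xy (within_continuous_segment iK cF Kx Ky) mM.
    by have := F0 z Kz; rewrite Fz eqxx.
  rewrite minC maxC in mM.
  have [z /(interval_segment iK Ky Kx) Kz Fz] :=
    IVT yx (within_continuous_segment iK cF Ky Kx) mM.
  by have := F0 z Kz; rewrite Fz eqxx.
have [[x0 [Kx0 Fx0]]|noP] := pselect (exists x, K x /\ 0 < F x).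
  by exists false => x Kx; rewrite mul1r gtr0_norm//; exact: pos Fx0.
exists true => x Kx; rewrite mulN1r ler0_norm ?opprK// leNgt; apply/negP => Fx.
by apply: noP; exists x.
Qed.

(** If [G x <> 0], divide [2 F F' = 2 G G'], squared, by the common value
    [4 F^2 = 4 G^2].  At a common zero that equation is void, and one compares
    instead the squared difference quotients, which coincide near [x]. *)
Lemma sqr_eq_is_derive F G (x dF dG : R) :
  (\near x, F x ^+ 2 = G x ^+ 2) ->
  is_derive x 1 F dF -> is_derive x 1 G dG -> dF ^+ 2 = dG ^+ 2.
Proof.
move=> FG hF hG; have FGx := nbhs_singleton FG.
have [G0|G0] := eqVneq (G x) 0; last first.
  have e : 2 * F x * dF = 2 * G x * dG.
    rewrite -(@derive_val _ _ _ _ _ _ _ (is_derive_sqr hF)).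
    rewrite -(@derive_val _ _ _ _ _ _ _ (is_derive_sqr hG)).
    exact: near_eq_derive.
  have : (2 * F x * dF) ^+ 2 = (2 * G x * dG) ^+ 2 by rewrite e.
  rewrite !exprMn FGx => /mulfI; apply.
  by rewrite mulf_neq0// expf_neq0// pnatr_eq0.
have F0 : F x = 0 by apply/eqP; rewrite -sqrf_eq0 FGx G0 expr0n.
(* [A] and [B] extend the difference quotients continuously to [x] *)
have /is_derive1_caratheodory [A [FA cA <-]] := hF.
have /is_derive1_caratheodory [B [GB cB <-]] := hG.
have AB : \forall z \near x^', A z * A z = B z * B z.
  near=> z; have zx : z != x by near: z; exact: nbhs_dnbhs_neq.
  have : F z ^+ 2 = G z ^+ 2 by near: z; exact: cvg_within.
  rewrite -[F z]subr0 -{1}F0 FA -[G z]subr0 -{1}G0 GB !exprMn -!expr2.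
  by move=> /mulIf; apply; rewrite sqrf_eq0 subr_eq0.
have cvg_sqr (H : R -> R) :
    {for x, continuous H} -> H z * H z @[z --> x^'] --> H x * H x.
  by move=> cH; apply: cvg_within_filter; exact: cvgM.
rewrite !expr2; apply: (cvg_unique _ (cvg_sqr A cA)) => //.
apply: cvg_trans (cvg_sqr B cB); apply: near_eq_cvg.
by apply: filterS AB => z ->.
Unshelve. all: by end_near. Qed.

(** The points near which [df] vanishes identically, together with those where
    [df <> 0], are dense in [K].  On both sets [dh = 0], on the second because
    [h] vanishes nearby; so [dh = 0] on [K], and [h] is constant. *)
Lemma vanishes_off_stationary K h df dh : open K -> is_interval K ->
  (forall x, K x -> {for x, continuous df}) ->
  (forall x, K x -> {for x, continuous dh}) ->
  (forall x, K x -> is_derive x 1 h (dh x)) ->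
  (forall x, K x -> df x != 0 -> h x = 0) ->
  (forall x, K x -> (\forall y \near x, df y = 0) -> dh x = 0) ->
  (exists2 x, K x & df x != 0) ->
  forall x, K x -> h x = 0.
Proof.
move=> oK iK cdf cdh hdh h0 dh0 [x0 Kx0 fx0].
have dh_eq0 x : K x -> dh x = 0.
  move=> Kx; apply/eqP/negPn/negP => dhx; move/negP: (dhx); apply; apply/eqP.
  apply: dh0 => //; near=> y; apply/eqP/negPn/negP => dfy.
  have Ky : K y by near: y; exact: (near_open oK).
  have : dh y != 0.
    by near: y; exact: cvgr_neq0 (cdh x Kx) dhx.
  apply/negP/negPn/eqP.
  rewrite -(@derive_val _ _ _ _ _ _ _ (hdh y Ky)) -[RHS](derive_cst 0 y 1).
  apply: near_eq_derive; near=> z; apply: h0.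
    by near: z; exact: (near_open oK).
  by near: z; exact: cvgr_neq0 (cdf y Ky) dfy.
move=> x Kx; rewrite -(h0 x0 Kx0 fx0).
apply: (interval_derive0_eq iK) => // y Ky.
by rewrite -(dh_eq0 y Ky); exact: hdh.
Unshelve. all: by end_near. Qed.

End Calculus.

Lemma is_derive_smooth (R : realType) (V : normedModType R) (I : set R)
    (h : R -> V) k x :
  smooth_on I h -> I x -> is_derive x 1 (derive1n k h) (derive1n k.+1 h x).
Proof.
by move=> hh Ix; rewrite derive1nS derive1E; exact: derivableP (hh k x Ix).
Qed.

(** * The differential equation of the meridian *)

Section Primitive.
Variable R : realType.
Implicit Types (a b c t : R).

(** Up to sign, the bracket is the elementary primitive of
    [sqrt (4 a^2 t^2 - b^2)].  The argument of the logarithm is positive here,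
    so the absolute value disappears near [t]. *)
Lemma is_derive_phi_bracket a b c inner t :
  0 < a -> 0 < t -> b ^+ 2 < 4 * a ^+ 2 * t ^+ 2 ->
  is_derive t 1 (phi_bracket a b c inner)
    (- (-1) ^+ inner * Num.sqrt (4 * a ^+ 2 * t ^+ 2 - b ^+ 2)).
Proof.
move=> a0 t0 bt; set q := fun s : R => 4 * a ^+ 2 * s ^+ 2 - b ^+ 2.
have q0 : 0 < q t by rewrite subr_gt0.
pose w s := Num.sqrt (q s); have w0 : 0 < w t by rewrite sqrtr_gt0.
have w2 : w t ^+ 2 = 4 * a ^+ 2 * t ^+ 2 - b ^+ 2 by rewrite sqr_sqrtr// ltW.
have did : is_derive t 1 (fun s : R => s) 1 by exact: is_derive_id.
have dq : is_derive t 1 q (8 * a ^+ 2 * t).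
  have dsq := is_derive_scale (4 * a ^+ 2) (is_derive_sqr did).
  apply: is_derive_eq (is_derive_sub dsq (is_derive_const (b ^+ 2) t)) _.
  by rewrite subr0; ring.
have dw : is_derive t 1 w (4 * a ^+ 2 * t / w t).
  apply: is_derive_eq (is_derive1_comp (is_derive1_sqrt q0) dq) _.
  by rewrite -/(w t); field; rewrite gt_eqF.
have dln : is_derive t 1 (fun s => ln `|2 * a * s + w s|) (2 * a / w t).
  have arg0 : 0 < 2 * a * t + w t by rewrite addr_gt0// !mulr_gt0.
  have darg : is_derive t 1 (fun s => 2 * a * s + w s)
      (2 * a * 1 + 4 * a ^+ 2 * t / w t).
    exact: is_derive_add (is_derive_scale _ did) dw.
  have dln := @is_derive1_comp _ (@ln R) (fun s => 2 * a * s + w s) _ _ _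
    (is_derive1_ln arg0) darg.
  apply: near_eq_is_derive (is_derive_eq dln _).
    near=> s; rewrite /= ger0_norm// ltW//; near: s.
    exact: cvgr_gt (is_derive_cvg darg) _ arg0.
  by field; rewrite !gt_eqF.
have dtw := is_derive_mul (is_derive_mul did (is_derive_const 2^-1 t)) dw.
have dln' := is_derive_scale ((-1) ^+ inner)
  (is_derive_scale (b ^+ 2 / (4 * a)) dln).
have dtw' := is_derive_sub (is_derive_const c t)
  (is_derive_scale ((-1) ^+ inner) dtw).
apply: is_derive_eq (is_derive_add dtw' dln') _.
rewrite -/(q t) -/(w t).
have -> : b ^+ 2 = 4 * a ^+ 2 * t ^+ 2 - w t ^+ 2 by rewrite w2; ring.
by move: w0 => {w2}; move: (w t) => r r0; field; rewrite !gt_eqF.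
Unshelve. all: by end_near. Qed.

End Primitive.

Section Meridian.
Variables (R : realType) (I : set R) (f g : R -> R).
Hypotheses (oI : open I) (hm : meridian_curve I f g).

(** [f (kappa_m + g'/f)], where [kappa_m] is the curvature of the meridian and
    [g'/f] that of the parallels along the normal [f' e_1 - g' l]: the second
    normal component of the mean curvature vector, up to the factor [2 f]. *)
Definition curvature_sum (u : R) : R :=
  f u * (derive1n 1 f u * derive1n 2 g u - derive1n 1 g u * derive1n 2 f u)
  + derive1n 1 g u.

Let W := curvature_sum.

Let df k u : I u -> is_derive u 1 (derive1n k f) (derive1n k.+1 f u).
Proof. by case: hm => sf _ _ _; exact: is_derive_smooth. Qed.

Let dg k u : I u -> is_derive u 1 (derive1n k g) (derive1n k.+1 g u).
Proof. by case: hm => _ sg _ _; exact: is_derive_smooth. Qed.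

Let f_gt0 u : I u -> 0 < f u. Proof. by case: hm => _ _ + _; exact. Qed.

Let unit_speed u : I u -> derive1n 1 f u ^+ 2 + derive1n 1 g u ^+ 2 = 1.
Proof. by case: hm => _ _ _; exact. Qed.

Lemma meridian_acceleration_orthogonal u : I u ->
  derive1n 1 f u * derive1n 2 f u + derive1n 1 g u * derive1n 2 g u = 0.
Proof.
move=> Iu.
have d := is_derive_add (is_derive_sqr (df 1 Iu)) (is_derive_sqr (dg 1 Iu)).
have /esym := @derive_val _ _ _ _ _ _ _ d.
rewrite (@near_eq_derive _ _ _ _ (fun=> 1 : R)) ?derive_cst.
  move: (derive1n 1 f u) (derive1n 2 f u) (derive1n 1 g u) (derive1n 2 g u).
  by move=> f1 f2 g1 g2 e; lra.
by apply: filterS (near_open oI Iu) => y; exact: unit_speed.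
Qed.

(** Since [f' kappa_m = g''] on a unit-speed curve, [f' W = f g'' + f' g']. *)
Lemma is_derive_meridian_moment u : I u ->
  is_derive u 1 (fun s => f s * derive1n 1 g s) (derive1n 1 f u * W u).
Proof.
move=> Iu; apply: is_derive_eq (is_derive_mul (df 0 Iu) (dg 1 Iu)) _.
have := meridian_acceleration_orthogonal Iu; have := unit_speed Iu.
rewrite /W /curvature_sum [derive1n 0 f u]/=.
set f1 := derive1n 1 f u; set g1 := derive1n 1 g u.
set f2 := derive1n 2 f u; set g2 := derive1n 2 g u.
move=> e1 e2; have e3 : f1 * f2 = - g1 * g2 by lra.
have -> : f1 * (f u * (f1 * g2 - g1 * f2) + g1) =
  f u * (f1 ^+ 2 * g2 - g1 * (f1 * f2)) + f1 * g1 by ring.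
rewrite e3 (_ : f1 ^+ 2 = 1 - g1 ^+ 2); last by lra.
ring.
Qed.

Lemma continuous_curvature_sum u : I u -> {for u, continuous W}.
Proof.
move=> Iu.
have k1 := is_derive_sub (is_derive_mul (df 1 Iu) (dg 2 Iu))
                         (is_derive_mul (dg 1 Iu) (df 2 Iu)).
exact: is_derive_cvg (is_derive_add (is_derive_mul (df 0 Iu) k1) (dg 1 Iu)).
Qed.

Lemma is_derive_bracket_comp a b c inner u : I u -> 0 < a ->
  b ^+ 2 < 4 * a ^+ 2 * f u ^+ 2 ->
  is_derive u 1 (fun s => phi_bracket a b c inner (f s))
    (- (-1) ^+ inner * Num.sqrt (4 * a ^+ 2 * f u ^+ 2 - b ^+ 2)
     * derive1n 1 f u).
Proof.
move=> Iu a0 bf.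
have := is_derive_phi_bracket c inner a0 (f_gt0 Iu) bf.
by move/(@is_derive1_comp _ _ f u); apply; exact: (df 0 Iu).
Qed.

(** On [K] the function [f g'] minus the bracket, with the inner sign opposite
    to that of [W], has derivative zero; its value is the constant [c]. *)
Lemma meridian_given_by_phiP a b : 0 < a ->
  (forall u, I u -> b ^+ 2 + W u ^+ 2 = 4 * a ^+ 2 * f u ^+ 2) ->
  meridian_given_by_phi I a b f.
Proof.
move=> a0 E; split=> [u Iu|K KI iK wK]; first by rewrite -E// lerDl sqr_ge0.
have W2 u : K u -> W u ^+ 2 = 4 * a ^+ 2 * f u ^+ 2 - b ^+ 2.
  by move=> /KI/E <-; rewrite addrAC subrr add0r.
(* [W] is the square root of [W^2] with a sign [s], fixed on all of [K]; it
   determines the inner sign of [phi], which is the opposite one *)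
have [u Ku||s Ws] := @interval_nonzero_sign _ K W iK.
- exact: continuous_curvature_sum (KI u Ku).
- by move=> u Ku; rewrite -sqrf_eq0 W2// subr_eq0 gt_eqF// wK.
pose D u := f u * derive1n 1 g u - phi_bracket a b 0 (~~ s) (f u).
have D_cst : forall x y, K x -> K y -> D x = D y.
  apply: (interval_derive0_eq iK) => u Ku; have Iu := KI u Ku.
  have dB := is_derive_bracket_comp 0 (~~ s) Iu a0 (wK u Ku).
  apply: is_derive_eq (is_derive_sub (is_derive_meridian_moment Iu) dB) _.
  rewrite -W2// sqrtr_sqr {1}Ws//; case: (s); rewrite /= ?expr0 ?expr1; ring.
(* [K] may be empty, and then the value of [c] is arbitrary *)
have [c hc] : exists c, forall u, K u -> D u = c.
  have [[u0 Ku0]|K0] := pselect (K !=set0).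
    by exists (D u0) => u Ku; exact: D_cst.
  by exists 0 => u Ku; exfalso; apply: K0; exists u.
exists c, (~~ s) => u Ku; have Iu := KI u Ku.
have radE : phi_radicand a b c (~~ s) (f u) = derive1 f u ^+ 2.
  rewrite /phi_radicand.
  have -> : phi_bracket a b c (~~ s) (f u) = f u * derive1n 1 g u.
    by have := hc u Ku; rewrite /D /phi_bracket => <-; ring.
  rewrite exprMn mulKf ?sqrf_eq0 ?gt_eqF ?f_gt0//.
  by rewrite -(unit_speed Iu) addrK.
split; first by rewrite radE sqr_ge0.
by exists (derive1 f u < 0); rewrite /phi radE sqrtr_sqr; exact: numEsign.
Qed.

Lemma solves_phi_sqr K a b : K `<=` I -> solves_phi K a b f ->
  exists c inner, forall u, K u ->
    (f u * derive1n 1 g u) ^+ 2 = phi_bracket a b c inner (f u) ^+ 2.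
Proof.
move=> KI [c [inner phiK]]; exists c, inner => u Ku; have Iu := KI u Ku.
have [rad_ge0 [outer /(congr1 (fun x => x ^+ 2))]] := phiK u Ku.
rewrite /phi exprMn sqrr_sign mul1r sqr_sqrtr// /phi_radicand => f1E.
have f0 : f u ^+ 2 != 0 by rewrite sqrf_eq0 gt_eqF// f_gt0.
rewrite exprMn -[RHS](mulVKf f0); congr (_ * _).
have := unit_speed Iu; rewrite [derive1n 1 f u]/= f1E.
by move=> e; lra.
Qed.

(** Such a point is a minimum of [f], by the bound on [f]. *)
Lemma derive0_at_least_radius a b u :
  (forall v, I v -> b ^+ 2 <= 4 * a ^+ 2 * f v ^+ 2) -> 0 < a ->
  I u -> b ^+ 2 = 4 * a ^+ 2 * f u ^+ 2 -> derive1 f u = 0.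
Proof.
move=> bf a0 Iu bu.
have /nbhs_ballP[e/= e0 eI] := near_open oI Iu.
have inI t : t \in `]u - e, u + e[%R -> I t.
  by move=> tue; apply: eI; rewrite ball_itv/= in tue *.
have uue : u \in `]u - e, u + e[%R by rewrite in_itv/= ltrBlDr !ltrDl e0.
have : is_derive u 1 f 0.
  apply: (derive1_at_min _ _ uue) => [|t /inI It|t /inI It].
  - by rewrite lerBlDr -addrA lerDl addr_ge0// ltW.
  - by case: (df 0 It).
  have := bf t It; rewrite bu ler_pM2l ?mulr_gt0 ?exprn_gt0//.
  by rewrite ler_sqr// nnegrE ltW// f_gt0.
by rewrite derive1E => -[_ ->].
Qed.

(** At such a point [b^2 < 4 a^2 f^2], so [f' = phi(f)] holds on a
    neighbourhood; differentiating the resulting equality of squares leaves the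
    factor [f'^2], which can be cancelled.  Comparing squares covers the points
    where [g' = 0] as well, and absorbs the signs of [f'] and [g']. *)
Lemma sqr_curvature_sum a b u : 0 < a -> meridian_given_by_phi I a b f ->
  I u -> derive1n 1 f u != 0 ->
  b ^+ 2 + W u ^+ 2 = 4 * a ^+ 2 * f u ^+ 2.
Proof.
move=> a0 [bf phiI] Iu f1u.
pose q s := 4 * a ^+ 2 * f s ^+ 2.
have qu : b ^+ 2 < q u.
  rewrite lt_neqAle bf// andbT; apply/eqP => bu.
  by move/eqP: f1u; apply; exact: derive0_at_least_radius bu.
have cq : {for u, continuous q}.
  exact: is_derive_cvg (is_derive_scale (4 * a ^+ 2) (is_derive_sqr (df 0 Iu))).
have /nbhs_ballP[e/= e0 eI] : \forall s \near u, I s /\ b ^+ 2 < q s.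
  by near=> s; split; near: s; [exact: near_open|exact: cvgr_gt cq _ qu].
have iK : is_interval (ball u e).
  by rewrite ball_itv; exact: interval_is_interval.
have KI : ball u e `<=` I by move=> s /eI [].
have [|c [inner FG]] := solves_phi_sqr KI (phiI _ KI iK _).
  by move=> s /eI [].
have dF := is_derive_meridian_moment Iu.
have dG := is_derive_bracket_comp c inner Iu a0 qu.
have : (derive1n 1 f u * W u) ^+ 2 =
  (- (-1) ^+ inner * Num.sqrt (q u - b ^+ 2) * derive1n 1 f u) ^+ 2.
  apply: sqr_eq_is_derive dF dG.
  by apply: filterS (nbhsx_ballx u e e0) => s; exact: FG.
rewrite !exprMn sqrrN sqrr_sign mul1r sqr_sqrtr ?subr_ge0 1?ltW// mulrC.
by move/mulIf => ->; rewrite ?sqrf_eq0// addrC subrK.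
Unshelve. all: by end_near. Qed.

(** On an arc where [f] is constant the differential equation does not determine
    [W].  There the defect [h] of the equation is constant, and it is compared
    with its value at the points where [f' <> 0], by [vanishes_off_stationary];
    this is where the smoothness of the meridian up to order 3 enters. *)
Lemma given_by_phi_meridianP a b : is_interval I ->
  ~ (exists r, forall u, I u -> f u = r) -> 0 < a ->
  meridian_given_by_phi I a b f ->
  forall u, I u -> b ^+ 2 + W u ^+ 2 = 4 * a ^+ 2 * f u ^+ 2.
Proof.
move=> iI hf a0 hphi.
pose dW u :=
  derive1n 1 f u
    * (derive1n 1 f u * derive1n 2 g u - derive1n 1 g u * derive1n 2 f u)
  + f u * (derive1n 1 f u * derive1n 3 g u - derive1n 1 g u * derive1n 3 f u)
  + derive1n 2 g u.
have dWE u : I u -> is_derive u 1 W (dW u).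
  move=> Iu.
  have k1 := is_derive_sub (is_derive_mul (df 1 Iu) (dg 2 Iu))
                           (is_derive_mul (dg 1 Iu) (df 2 Iu)).
  apply: is_derive_eq (is_derive_add (is_derive_mul (df 0 Iu) k1) (dg 1 Iu)) _.
  rewrite /dW [derive1n 0 f u]/=.
  move: (derive1n 1 f u) (derive1n 2 f u) (derive1n 3 f u).
  move: (derive1n 1 g u) (derive1n 2 g u) (derive1n 3 g u) (f u).
  by move=> *; ring.
pose h u := b ^+ 2 + W u ^+ 2 - 4 * a ^+ 2 * f u ^+ 2.
pose dh u := 2 * W u * dW u - 4 * a ^+ 2 * (2 * f u * derive1n 1 f u).
have dhE u : I u -> is_derive u 1 h (dh u).
  move=> Iu.
  have d := is_derive_add (is_derive_const (b ^+ 2) u)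
    (is_derive_sqr (dWE u Iu)).
  have d2 := is_derive_scale (4 * a ^+ 2) (is_derive_sqr (df 0 Iu)).
  by apply: is_derive_eq (is_derive_sub d d2) _; rewrite add0r.
suff h0 u : I u -> h u = 0 by move=> u /h0 /eqP; rewrite subr_eq0 => /eqP.
apply: (vanishes_off_stationary (df := derive1n 1 f) oI iI _ _ dhE).
- by move=> x Ix; exact: is_derive_cvg (df 1 Ix).
- move=> x Ix.
  have k1 := is_derive_sub (is_derive_mul (df 1 Ix) (dg 2 Ix))
                           (is_derive_mul (dg 1 Ix) (df 2 Ix)).
  have k2 := is_derive_sub (is_derive_mul (df 1 Ix) (dg 3 Ix))
                           (is_derive_mul (dg 1 Ix) (df 3 Ix)).
  have dd := is_derive_add (is_derive_add (is_derive_mul (df 1 Ix) k1)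
    (is_derive_mul (df 0 Ix) k2)) (dg 2 Ix).
  have dff := is_derive_mul (is_derive_scale 2 (df 0 Ix)) (df 1 Ix).
  exact: is_derive_cvg (is_derive_sub
    (is_derive_mul (is_derive_scale 2 (dWE x Ix)) dd)
    (is_derive_scale (4 * a ^+ 2) dff)).
- move=> x Ix f1x; apply/eqP; rewrite subr_eq0; apply/eqP.
  exact: sqr_curvature_sum.
- move=> x Ix f1x.
  (* [f] is constant near [x], so [f'], [f''] and [f'''] vanish at [x], and so
     does [g''], because [g'^2 = 1]; every term of [dh x] contains one of them *)
  have f10 := nbhs_singleton f1x.
  have f2x : \forall y \near x, derive1n 2 f y = 0.
    have := near_join f1x; apply: filterS => y f1y.
    by rewrite derive1nS derive1E (near_eq_derive _ f1y) derive_cst.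
  have f20 := nbhs_singleton f2x.
  have f30 : derive1n 3 f x = 0.
    by rewrite derive1nS derive1E (near_eq_derive _ f2x) derive_cst.
  have g20 : derive1n 2 g x = 0.
    have := meridian_acceleration_orthogonal Ix; have := unit_speed Ix.
    rewrite f10 f20 expr0n mulr0 !add0r.
    move: (derive1n 1 g x) (derive1n 2 g x) => g1 g2 speed orth.
    by rewrite -[g2]mul1r -speed expr2 -mulrA orth mulr0.
  rewrite /dh /dW f10 f20 f30 g20; ring.
- apply: contrapT => nof1; apply: hf.
  have [[x0 Ix0]|I0] := pselect (I !=set0); last first.
    by exists 0 => v Iv; exfalso; apply: I0; exists v.
  exists (f x0) => v Iv; apply: (interval_derive0_eq iI) => // y Iy.
  apply: is_derive_eq (df 0 Iy) _.
  by apply/eqP/negPn/negP => f1y; apply: nof1; exists y.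
Qed.

End Meridian.

(** * The Minkowski product *)

Section MinkowskiProduct.
Variable R : realType.
Implicit Types (x y w : 'rV[R]_4) (k : R).

Lemma mdotC x y : mdot x y = mdot y x.
Proof. by apply: eq_bigr => i _; rewrite [x 0 i * _]mulrC. Qed.

Lemma mdotDl x y w : mdot (x + y) w = mdot x w + mdot y w.
Proof.
by rewrite -big_split; apply: eq_bigr => i _ /=; rewrite mxE mulrDl mulrDr.
Qed.

Lemma mdotZl k x w : mdot (k *: x) w = k * mdot x w.
Proof.
by rewrite /mdot mulr_sumr; apply: eq_bigr => i _; rewrite mxE; ring.
Qed.

Lemma mdotNl x w : mdot (- x) w = - mdot x w.
Proof. by rewrite -scaleN1r mdotZl mulN1r. Qed.

Lemma mdotDr x y w : mdot w (x + y) = mdot w x + mdot w y.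
Proof. by rewrite mdotC mdotDl !(mdotC w). Qed.

Lemma mdotZr k x w : mdot w (k *: x) = k * mdot w x.
Proof. by rewrite mdotC mdotZl (mdotC w). Qed.

Lemma mdotNr x w : mdot w (- x) = - mdot w x.
Proof. by rewrite mdotC mdotNl (mdotC w). Qed.

Definition mdot_bilinear := (mdotDl, mdotDr, mdotNl, mdotNr, mdotZl, mdotZr).

Lemma mdot_frame_vec (i j : 'I_4) :
  mdot (frame_vec R i) (frame_vec R j) = (-1) ^+ (i == ord_max) *+ (i == j).
Proof.
rewrite /mdot (bigD1 i)//= big1 ?addr0; last first.
  by move=> k ki; rewrite !mxE /= (negPf ki) mul0r mulr0.
by rewrite !mxE !eqxx mul1r mulr_natr.
Qed.

Lemma mdot_span234 x : in_span234 x -> mdot (frame_vec R 0) x = 0.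
Proof.
move=> [c2 [c3 [c4 ->]]].
by rewrite !mdot_bilinear !mdot_frame_vec /= !mulr0n !mulr0 !addr0.
Qed.

(** The Gram relations say that the matrix of the [B i], adjusted by the signs
    of the metric, has as right inverse its transpose, adjusted by the signs of
    the frame.  The product in the other order is then the identity too, and
    this is the expansion. *)
Lemma orthonormal_expansion (B : 'I_4 -> 'rV[R]_4) (eps : 'I_4 -> R) :
  (forall i, eps i ^+ 2 = 1) ->
  (forall i j, mdot (B i) (B j) = eps i *+ (i == j)) ->
  forall x, x = \sum_i (eps i * mdot x (B i)) *: B i.
Proof.
move=> eps1 BB x.
pose P : 'M[R]_4 := \matrix_(i, k) ((-1) ^+ (k == ord_max) * B i 0 k).
pose Q : 'M[R]_4 := \matrix_(k, j) (B j 0 k * eps j).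
have PQ : P *m Q = 1%:M.
  apply/matrixP => i j; rewrite !mxE; under eq_bigr do rewrite !mxE.
  transitivity (mdot (B i) (B j) * eps j).
    by rewrite mulr_suml; apply: eq_bigr => k _; ring.
  by rewrite BB mulrnAl; case: eqP => [->|]; rewrite ?mulr0n// -expr2 eps1.
have /matrixP QP := mulmx1C PQ.
apply/rowP => h; rewrite summxE.
transitivity (\sum_k \sum_i x 0 k * (Q h i * P i k)).
  transitivity (\sum_k x 0 k * (1%:M : 'M[R]_4) h k).
    rewrite (bigD1 h)//= big1 ?addr0 ?mxE ?eqxx ?mulr1// => k kh.
    by rewrite mxE eq_sym (negPf kh) mulr0.
  by apply: eq_bigr => k _; rewrite -QP mxE mulr_sumr.
rewrite exchange_big; apply: eq_bigr => i _ /=.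
rewrite [RHS]mxE /mdot mulr_sumr mulr_suml; apply: eq_bigr => k _.
by rewrite !mxE; ring.
Qed.

(** Together with [e_1] the three vectors form an orthonormal basis of the whole
    space, and the component of [x] along [e_1] is zero. *)
Lemma spherical_frame_expansion l t n x :
  mdot l l = 1 -> mdot t t = -1 -> mdot n n = 1 ->
  mdot l t = 0 -> mdot n l = 0 -> mdot n t = 0 ->
  mdot (frame_vec R 0) l = 0 -> mdot (frame_vec R 0) t = 0 ->
  mdot (frame_vec R 0) n = 0 -> mdot (frame_vec R 0) x = 0 ->
  x = mdot x l *: l - mdot x t *: t + mdot x n *: n.
Proof.
move=> ll tt nn lt nl nt el et en ex.
pose B (i : 'I_4) := tnth [tuple frame_vec R 0; l; t; n] i.
pose eps (i : 'I_4) : R := tnth [tuple 1; 1; -1; 1] i.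
have ee : mdot (frame_vec R 0) (frame_vec R 0) = 1 by rewrite mdot_frame_vec.
rewrite {1}[x](@orthonormal_expansion B eps).
- rewrite !big_ord_recl big_ord0 /B /eps !(tnth_nth 0) /= mdotC ex.
  by rewrite mulr0 scale0r add0r addr0 !mul1r mulN1r scaleNr addrA.
- by move=> i; rewrite /eps (tnth_nth 0); case: i => [[|[|[|[|]]]]]//= _; ring.
- move=> i j; rewrite /B /eps !(tnth_nth 0).
  by case: i => [[|[|[|[|]]]]]//= ?; case: j => [[|[|[|[|]]]]]//= ?;
    rewrite ?(mdotC _ (frame_vec R 0)) ?el ?et ?en ?ee ?ll ?tt ?nn ?lt ?nl ?nt;
    rewrite // mdotC ?lt ?nl ?nt.
Qed.

End MinkowskiProduct.

Section VectorCalculus.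
Variable R : realType.
Implicit Types (X Y : R -> 'rV[R]_4) (v : R).

Lemma is_derive_coord X v dX (i : 'I_4) :
  is_derive v 1 X dX -> is_derive v 1 (fun s => X s 0 i) (dX 0 i).
Proof.
move=> [hX <-]; have /derivable_mxP/(_ 0 i) hXi := hX.
by apply: (is_derive_eq (derivableP hXi)); rewrite derive_mx// mxE.
Qed.

Lemma is_derive_scalel (F : R -> R) v dF (w : 'rV[R]_4) :
  is_derive v 1 F dF -> is_derive v 1 (fun s => F s *: w) (dF *: w).
Proof.
move=> hF; have d i j : is_derive v 1 (fun s => (F s *: w) i j) (dF * w i j).
  rewrite (_ : (fun _ => _) = fun s => w i j * F s).
    by rewrite mulrC; exact: is_derive_scale.
  by apply/funext => s; rewrite mxE mulrC.
have der : derivable (fun s => F s *: w) v 1.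
  by apply/derivable_mxP => i j; case: (d i j).
split=> //; rewrite derive_mx//; apply/matrixP => i j; rewrite !mxE.
by case: (d i j).
Qed.

Lemma is_derive_mdot X Y v dX dY :
  is_derive v 1 X dX -> is_derive v 1 Y dY ->
  is_derive v 1 (fun s => mdot (X s) (Y s)) (mdot dX (Y v) + mdot (X v) dY).
Proof.
move=> hX hY.
have d (i : 'I_4) := is_derive_scale ((-1) ^+ (i == ord_max))
  (is_derive_mul (is_derive_coord i hX) (is_derive_coord i hY)).
apply: is_derive_eq.
  rewrite (_ : (fun s => mdot (X s) (Y s)) =
    \sum_(i < 4) (fun s => (-1) ^+ (i == ord_max) * (X s 0 i * Y s 0 i))).
    exact: is_derive_sum.
  by apply/funext => s; rewrite fct_sumE.
by rewrite -big_split; apply: eq_bigr => i _ /=; rewrite -mulrDr.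
Qed.

End VectorCalculus.

(** * Timelike curves on the de Sitter space *)

Section SphericalCurve.
Variables (R : realType) (J : set R) (l n : R -> 'rV[R]_4).
Hypotheses (oJ : open J) (hl : timelike_spherical_curve J l).
Hypothesis hn : spherical_normal J l n.

Let dl k v : J v -> is_derive v 1 (derive1n k l) (derive1n k.+1 l v).
Proof. by case: hl => sl _ _; exact: is_derive_smooth. Qed.

Lemma derive_mdot_const X Y dX dY v c : J v ->
  (forall s, J s -> mdot (X s) (Y s) = c) ->
  is_derive v 1 X dX -> is_derive v 1 Y dY ->
  mdot dX (Y v) + mdot (X v) dY = 0.
Proof.
move=> Jv XYc hX hY; have [_ <-] := is_derive_mdot hX hY.
rewrite (@near_eq_derive _ _ _ _ (fun=> c : R)) ?derive_cst//.
by apply: filterS (near_open oJ Jv).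
Qed.

Lemma spherical_curve_ll v : J v -> mdot (l v) (l v) = 1.
Proof. by case: hl => _ + _ => /[apply] -[]. Qed.

Lemma spherical_curve_tt v : J v -> mdot (derive1n 1 l v) (derive1n 1 l v) = -1.
Proof. by case: hl => _ _; exact. Qed.

Lemma spherical_curve_lt v : J v -> mdot (l v) (derive1n 1 l v) = 0.
Proof.
move=> Jv; have := derive_mdot_const Jv spherical_curve_ll (dl 0 Jv) (dl 0 Jv).
by rewrite (mdotC _ (derive1n 0 l v)) => e; lra.
Qed.

Lemma spherical_curve_l_acceleration v : J v -> mdot (l v) (derive1n 2 l v) = 1.
Proof.
move=> Jv; have := derive_mdot_const Jv spherical_curve_lt (dl 0 Jv) (dl 1 Jv).
by rewrite spherical_curve_tt// => e; lra.
Qed.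

Lemma spherical_curve_t_acceleration v : J v ->
  mdot (derive1n 1 l v) (derive1n 2 l v) = 0.
Proof.
move=> Jv; have := derive_mdot_const Jv spherical_curve_tt (dl 1 Jv) (dl 1 Jv).
by rewrite (mdotC _ (derive1n 1 l v)) => e; lra.
Qed.

Lemma spherical_curve_e1 v k : J v -> mdot (frame_vec R 0) (derive1n k l v) = 0.
Proof.
elim: k v => [|k IH] v Jv.
  by case: hl => _ /(_ v Jv) [/mdot_span234].
have := derive_mdot_const Jv IH (is_derive_cst (frame_vec R 0) v 1) (dl k Jv).
by rewrite -[X in mdot X _](scale0r (0 : 'rV[R]_4)) mdotZl mul0r add0r.
Qed.

(** The components of [l''] along [l] and [l'] come from differentiating
    [<l, l'> = 0] and [<l', l'> = -1]; the one along [n] is the curvature by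
    definition. *)
Lemma spherical_frenet v : J v ->
  derive1n 2 l v = l v + spherical_curvature l n v *: n v.
Proof.
move=> Jv; have [_ /(_ v Jv) [/mdot_span234 en nn nl nt]] := hn.
rewrite {1}[derive1n 2 l v](@spherical_frame_expansion _
  (l v) (derive1n 1 l v) (n v))//.
- rewrite (mdotC _ (l v)) spherical_curve_l_acceleration//.
  rewrite (mdotC _ (derive1n 1 l v)) spherical_curve_t_acceleration//.
  by rewrite scale1r scale0r subr0.
- exact: spherical_curve_ll.
- exact: spherical_curve_tt.
- exact: spherical_curve_lt.
- exact: (spherical_curve_e1 0).
- exact: (spherical_curve_e1 1).
- exact: (spherical_curve_e1 2).
Qed.

Lemma continuous_spherical_curvature v : J v ->
  {for v, continuous (spherical_curvature l n)}.
Proof.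
move=> Jv; case: hn => sn _.
exact: is_derive_cvg (is_derive_mdot (dl 2 Jv) (is_derive_smooth 0 sn Jv)).
Qed.

End SphericalCurve.

(** * The mean curvature of a meridian surface *)

Section MeanCurvature.
Variable R : realType.

(** The hypotheses say that the rows of the matrix of the [p]'s and [q]'s, with
    the second column scaled by [r], are Lorentz-orthonormal.  The conclusions
    say it of the columns. *)
Lemma lorentz_frame_dual (r p1 p2 q1 q2 : R) : r != 0 ->
  p1 ^+ 2 - r ^+ 2 * p2 ^+ 2 = 1 -> q1 ^+ 2 - r ^+ 2 * q2 ^+ 2 = -1 ->
  p1 * q1 - r ^+ 2 * (p2 * q2) = 0 ->
  [/\ p1 ^+ 2 - q1 ^+ 2 = 1, p1 * p2 - q1 * q2 = 0
    & p2 ^+ 2 - q2 ^+ 2 = - (r ^+ 2)^-1].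
Proof.
move=> r0 pp qq pq.
have e1 : p1 ^+ 2 - q1 ^+ 2 = 1.
  have : (p1 * q1) ^+ 2 = (r ^+ 2 * (p2 * q2)) ^+ 2 by congr (_ ^+ 2); lra.
  rewrite (_ : (r ^+ 2 * (p2 * q2)) ^+ 2
    = (r ^+ 2 * p2 ^+ 2) * (r ^+ 2 * q2 ^+ 2)); last by ring.
  rewrite (_ : r ^+ 2 * p2 ^+ 2 = p1 ^+ 2 - 1); last by lra.
  rewrite (_ : r ^+ 2 * q2 ^+ 2 = q1 ^+ 2 + 1); last by lra.
  by rewrite exprMn => e; lra.
have r2 : r ^+ 2 != 0 by rewrite sqrf_eq0.
have p10 : p1 != 0.
  apply/eqP => p10; move: pp; rewrite p10 expr0n /= sub0r => e.
  have := sqr_ge0 (r * p2); rewrite exprMn; lra.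
split=> //.
  apply: (mulfI p10); apply: (mulfI r2); rewrite !mulr0.
  transitivity (r ^+ 2 * p2 * p1 ^+ 2 - (p1 * q1) * (r ^+ 2 * q2)).
    by ring.
  rewrite (_ : p1 * q1 = r ^+ 2 * (p2 * q2)); last by lra.
  rewrite (_ : p1 ^+ 2 = r ^+ 2 * q2 ^+ 2); last by lra.
  by ring.
by apply: (mulfI r2); rewrite mulrN divff//; lra.
Qed.

Lemma normal_part_sub (X Y w w' : 'rV[R]_4) :
  normal_part X Y w - normal_part X Y w' = normal_part X Y (w - w').
Proof.
by apply/rowP => i; rewrite /normal_part !mdot_bilinear !mxE; ring.
Qed.

Lemma mdot_normal_part (X Y w : 'rV[R]_4) :
  mdot X X = 1 -> mdot Y Y = -1 -> mdot X Y = 0 ->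
  mdot (normal_part X Y w) (normal_part X Y w)
  = mdot w w - mdot w X ^+ 2 + mdot w Y ^+ 2.
Proof.
move=> XX YY XY; rewrite /normal_part !mdot_bilinear.
by rewrite (mdotC Y X) (mdotC X w) (mdotC Y w) XX YY XY; ring.
Qed.

(** Independence of the mean curvature vector of the orthonormal frame: by
    [lorentz_frame_dual] the mixed second derivatives cancel in
    [sigma(x, x) - sigma(y, y)], and what remains is the normal part of
    [z_uu - z_vv / r^2]. *)
Lemma mdot_frame_trace (A B zuu zuv zvu zvv : 'rV[R]_4) (p q : R * R) (r : R) :
  let comb (s : R * R) := s.1 *: A + s.2 *: B in
  let second (s : R * R) := (s.1 * s.1) *: zuu + (s.1 * s.2) *: zuv
    + (s.2 * s.1) *: zvu + (s.2 * s.2) *: zvv in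
  let normal := normal_part (comb p) (comb q) in
  let H := 2^-1 *: (normal (second p) - normal (second q)) in
  let S := zuu - (r ^+ 2)^-1 *: zvv in
  r != 0 -> mdot A A = 1 -> mdot B B = - r ^+ 2 -> mdot A B = 0 ->
  mdot (comb p) (comb p) = 1 -> mdot (comb q) (comb q) = -1 ->
  mdot (comb p) (comb q) = 0 ->
  mdot H H = 4^-1 * (mdot S S - mdot S A ^+ 2 + (r ^+ 2)^-1 * mdot S B ^+ 2).
Proof.
move=> comb second normal H S r0 AA BB AB pp qq pq.
have [e1 e2 e3] : [/\ p.1 ^+ 2 - q.1 ^+ 2 = 1, p.1 * p.2 - q.1 * q.2 = 0
    & p.2 ^+ 2 - q.2 ^+ 2 = - (r ^+ 2)^-1].
  move: pp qq pq; rewrite /comb !mdot_bilinear (mdotC B) AA BB AB.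
  by move=> pp qq pq; apply: lorentz_frame_dual r0 _ _ _; lra.
have HE : H = 2^-1 *: normal_part (comb p) (comb q) S.
  rewrite /H /normal normal_part_sub; congr (_ *: normal_part _ _ _).
  rewrite /second /S; apply/rowP => i; rewrite !mxE.
  move: (zuu 0 i) (zuv 0 i) (zvu 0 i) (zvv 0 i) => a b c d.
  rewrite -mulNr -e3 -[a in RHS]mul1r -e1.
  by rewrite -[RHS]addr0 -(mul0r (b + c)) -e2; ring.
rewrite {}HE; clearbody S.
rewrite mdotZl mdotZr mdot_normal_part// /comb !(mdotDr _ _ S) !(mdotZr _ _ S).
move: (mdot S S) (mdot S A) (mdot S B) => s x y.
transitivity (4^-1 * (s - (p.1 ^+ 2 - q.1 ^+ 2) * x ^+ 2
  - (p.2 ^+ 2 - q.2 ^+ 2) * y ^+ 2 - 2 * (p.1 * p.2 - q.1 * q.2) * x * y)).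
  by field.
by rewrite e1 e2 e3; field.
Qed.

Lemma mdot_mean_curvature (z : R -> R -> 'rV[R]_4) u v p q (r : R) : r != 0 ->
  mdot (d_u z u v) (d_u z u v) = 1 -> mdot (d_v z u v) (d_v z u v) = - r ^+ 2 ->
  mdot (d_u z u v) (d_v z u v) = 0 -> orthonormal_frame z u v p q ->
  let S := d_u (d_u z) u v - (r ^+ 2)^-1 *: d_v (d_v z) u v in
  mdot (mean_curvature_vector z u v p q) (mean_curvature_vector z u v p q)
  = 4^-1 * (mdot S S - mdot S (d_u z u v) ^+ 2
            + (r ^+ 2)^-1 * mdot S (d_v z u v) ^+ 2).
Proof. by move=> r0 AA BB AB [pp qq pq]; exact: mdot_frame_trace. Qed.

End MeanCurvature.

Section SurfaceDerivatives.
Variables (R : realType) (I J : set R) (f g : R -> R) (l : R -> 'rV[R]_4).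
Hypotheses (oI : open I) (oJ : open J) (hm : meridian_curve I f g).
Hypothesis hl : timelike_spherical_curve J l.

Let z := meridian_surface f g l.
Let e1 := frame_vec R 0.

Let df k u : I u -> is_derive u 1 (derive1n k f) (derive1n k.+1 f u).
Proof. by case: hm => sf _ _ _; exact: is_derive_smooth. Qed.

Let dg k u : I u -> is_derive u 1 (derive1n k g) (derive1n k.+1 g u).
Proof. by case: hm => _ sg _ _; exact: is_derive_smooth. Qed.

Let dl k v : J v -> is_derive v 1 (derive1n k l) (derive1n k.+1 l v).
Proof. by case: hl => sl _ _; exact: is_derive_smooth. Qed.

Lemma d_u_surface u v : I u ->
  d_u z u v = derive1n 1 f u *: l v + derive1n 1 g u *: e1.
Proof.
move=> Iu; rewrite /d_u derive1E.
have [_ <-] := is_deriveD (is_derive_scalel (l v) (df 0 Iu))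
                          (is_derive_scalel e1 (dg 0 Iu)).
by [].
Qed.

Lemma d_uu_surface u v : I u ->
  d_u (d_u z) u v = derive1n 2 f u *: l v + derive1n 2 g u *: e1.
Proof.
move=> Iu; rewrite {1}/d_u derive1E.
have [_ <-] := is_deriveD (is_derive_scalel (l v) (df 1 Iu))
                          (is_derive_scalel e1 (dg 1 Iu)).
apply: near_eq_derive.
by apply: filterS (near_open oI Iu) => s; exact: d_u_surface.
Qed.

Lemma d_v_surface u v : J v -> d_v z u v = f u *: derive1n 1 l v.
Proof.
move=> Jv; rewrite /d_v derive1E -[RHS]addr0.
have [_ <-] := is_deriveD (is_deriveZ (f u) (dl 0 Jv))
                          (is_derive_cst (g u *: e1) v 1).
by [].
Qed.

Lemma d_vv_surface u v : J v -> d_v (d_v z) u v = f u *: derive1n 2 l v.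
Proof.
move=> Jv; rewrite {1}/d_v derive1E.
have [_ <-] := is_deriveZ (f u) (dl 1 Jv).
apply: near_eq_derive.
by apply: filterS (near_open oJ Jv) => s; exact: d_v_surface.
Qed.

End SurfaceDerivatives.

Section Gram.
Variables (R : realType) (l t n : 'rV[R]_4).
Let e1 := frame_vec R 0.
Hypotheses (ll : mdot l l = 1) (tt : mdot t t = -1) (nn : mdot n n = 1).
Hypotheses (lt : mdot l t = 0) (nl : mdot n l = 0) (nt : mdot n t = 0).
Hypotheses (el : mdot e1 l = 0) (et : mdot e1 t = 0) (en : mdot e1 n = 0).

Let ee : mdot e1 e1 = 1. Proof. by rewrite mdot_frame_vec. Qed.
Let gram := (ee, el, et, en, ll, tt, nn, lt, nl, nt).
Let gram_sym :=
  (mdotC l e1, mdotC t e1, mdotC n e1, mdotC t l, mdotC l n, mdotC t n).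

Lemma first_form_gram f1 g1 r : f1 ^+ 2 + g1 ^+ 2 = 1 ->
  let A := f1 *: l + g1 *: e1 in let B := r *: t in
  [/\ mdot A A = 1, mdot B B = - r ^+ 2 & mdot A B = 0].
Proof.
move=> speed A B; rewrite /A /B !mdot_bilinear !gram_sym !gram.
rewrite -[X in _ = X]speed.
by split; ring.
Qed.

(** [f1, f2, g1, g2] stand for [f', f'', g', g''], and [S] for
    [z_uu - z_vv / f^2] after Frenet's formula.  With [m = f' g'' - g' f''] the
    curvature of the meridian, unit speed gives [m^2 = f''^2 + g''^2] and
    [g' m = - f''], which identify the two sides. *)
Lemma mean_curvature_gram f1 f2 g1 g2 r k : r != 0 ->
  f1 ^+ 2 + g1 ^+ 2 = 1 -> f1 * f2 + g1 * g2 = 0 ->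
  let A := f1 *: l + g1 *: e1 in let B := r *: t in
  let S := f2 *: l + g2 *: e1 - (r ^+ 2)^-1 *: (r *: (l + k *: n)) in
  4^-1 * (mdot S S - mdot S A ^+ 2 + (r ^+ 2)^-1 * mdot S B ^+ 2)
  = (k ^+ 2 + (r * (f1 * g2 - g1 * f2) + g1) ^+ 2) / (4 * r ^+ 2).
Proof.
move=> r0 speed orth A B S; rewrite /S /A /B !mdot_bilinear !gram_sym !gram.
set m := f1 * g2 - g1 * f2.
have m2 : m ^+ 2 = f2 ^+ 2 + g2 ^+ 2.
  transitivity ((f1 ^+ 2 + g1 ^+ 2) * (f2 ^+ 2 + g2 ^+ 2)
    - (f1 * f2 + g1 * g2) ^+ 2).
    by rewrite /m; ring.
  by rewrite speed orth; ring.
have g1m : g1 * m = - f2.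
  transitivity (f1 * (f1 * f2 + g1 * g2) - (f1 ^+ 2 + g1 ^+ 2) * f2).
    by rewrite /m; ring.
  by rewrite speed orth; ring.
have -> : (r * m + g1) ^+ 2
    = r ^+ 2 * m ^+ 2 + 2 * r * (g1 * m) + g1 ^+ 2 by ring.
rewrite m2 g1m (_ : g1 ^+ 2 = 1 - f1 ^+ 2); last by lra.
transitivity (4^-1 * (f2 ^+ 2 + g2 ^+ 2 - 2 * f2 / r + (1 + k ^+ 2) / r ^+ 2
  - (f1 * f2 + g1 * g2 - f1 / r) ^+ 2)); first by field.
by rewrite orth; field.
Qed.

End Gram.

Section MeridianSurface.
Variables (R : realType) (I J : set R) (f g : R -> R) (l n : R -> 'rV[R]_4).
Hypotheses (oI : open I) (oJ : open J) (hm : meridian_curve I f g).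
Hypotheses (hl : timelike_spherical_curve J l) (hn : spherical_normal J l n).

Let z := meridian_surface f g l.

Let f_gt0 u : I u -> 0 < f u. Proof. by case: hm => _ _ + _; exact. Qed.

Lemma first_fundamental_form u v : I u -> J v ->
  [/\ mdot (d_u z u v) (d_u z u v) = 1,
      mdot (d_v z u v) (d_v z u v) = - f u ^+ 2
    & mdot (d_u z u v) (d_v z u v) = 0].
Proof.
move=> Iu Jv; have [_ _ _ /(_ u Iu) speed] := hm.
rewrite (d_u_surface l hm v Iu) (d_v_surface f g hl u Jv).
apply: first_form_gram speed.
- exact: (spherical_curve_ll hl Jv).
- exact: (spherical_curve_tt hl Jv).
- exact: (spherical_curve_lt oJ hl Jv).
- exact: (spherical_curve_e1 oJ hl 0 Jv).
- exact: (spherical_curve_e1 oJ hl 1 Jv).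
Qed.

Lemma meridian_surface_mean_curvature u v p q : I u -> J v ->
  orthonormal_frame z u v p q ->
  mdot (mean_curvature_vector z u v p q) (mean_curvature_vector z u v p q)
  = (spherical_curvature l n v ^+ 2 + curvature_sum f g u ^+ 2)
    / (4 * f u ^+ 2).
Proof.
move=> Iu Jv pq; have [AA BB AB] := first_fundamental_form Iu Jv.
have f0 : f u != 0 by rewrite gt_eqF// f_gt0.
rewrite (mdot_mean_curvature f0 AA BB AB pq).
rewrite (d_uu_surface l oI hm v Iu) (d_vv_surface f g oJ hl u Jv).
rewrite (d_u_surface l hm v Iu) (d_v_surface f g hl u Jv).
rewrite (spherical_frenet oJ hl hn Jv).
have [_ /(_ v Jv) [/mdot_span234 en nn nl nt]] := hn.
have [_ _ _ /(_ u Iu) speed] := hm.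
apply: mean_curvature_gram f0 speed (meridian_acceleration_orthogonal oI hm Iu).
- exact: (spherical_curve_ll hl Jv).
- exact: nn.
- exact: (spherical_curve_lt oJ hl Jv).
- exact: nl.
- exact: nt.
- exact: (spherical_curve_e1 oJ hl 0 Jv).
- exact: (spherical_curve_e1 oJ hl 1 Jv).
- exact: en.
Qed.

(** The hypothesis on [H] quantifies over all orthonormal frames, so that it has
    content only once one exists: [z_u, z_v / f]. *)
Lemma mean_curvature_norm_isP a : 0 < a ->
  mean_curvature_norm_is I J z a <->
  forall u v, I u -> J v ->
    spherical_curvature l n v ^+ 2 + curvature_sum f g u ^+ 2
    = 4 * a ^+ 2 * f u ^+ 2.
Proof.
move=> a0.
have sq u x :
    I u -> (x / (4 * f u ^+ 2) = a ^+ 2) <-> x = 4 * a ^+ 2 * f u ^+ 2.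
  move=> Iu; have f0 : f u != 0 by rewrite gt_eqF// f_gt0.
  by split=> [<-|->]; field; exact: f0.
split=> [H u v Iu Jv|E u v Iu Jv p q pq]; last first.
  rewrite /mnorm (meridian_surface_mean_curvature Iu Jv pq).
  by have /(sq u _ Iu) -> := E u v Iu Jv; rewrite sqrtr_sqr gtr0_norm.
have f0 : f u != 0 by rewrite gt_eqF// f_gt0.
have pq : orthonormal_frame z u v (1, 0) (0, (f u)^-1).
  have [AA BB AB] := first_fundamental_form Iu Jv.
  have frame (A B : 'rV[R]_4) :
      mdot A A = 1 -> mdot B B = - f u ^+ 2 -> mdot A B = 0 ->
      let x := 1 *: A + 0 *: B in let y := 0 *: A + (f u)^-1 *: B in
      [/\ mdot x x = 1, mdot y y = -1 & mdot x y = 0].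
    move=> AA' BB' AB' x y; rewrite /x /y !scale0r !scale1r addr0 add0r.
    by rewrite !mdotZr mdotZl AA' BB' AB'; split=> //; [field|rewrite mulr0].
  exact: frame AA BB AB.
apply/(sq u _ Iu); rewrite -(meridian_surface_mean_curvature Iu Jv pq).
rewrite -(H u v Iu Jv _ _ pq) /mnorm sqr_sqrtr//.
rewrite (meridian_surface_mean_curvature Iu Jv pq).
by apply: divr_ge0; [rewrite addr_ge0 ?sqr_ge0|rewrite mulr_ge0 ?sqr_ge0].
Qed.

End MeridianSurface.

(** * The characterization of constant mean curvature *)

Theorem theorem7p1 (R : realType) (I J : set R) (f g : R -> R)
    (l n : R -> 'rV[R]_4) (a : R)
    (hI : open_itv I) (hJ : open_itv J)
    (hm : meridian_curve I f g)
    (hl : timelike_spherical_curve J l)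
    (hn : spherical_normal J l n)
    (hkappa : exists v, J v /\ spherical_curvature l n v <> 0)
    (hf : ~ exists r : R, forall u, I u -> f u = r)
    (ha : 0 < a) :
  mean_curvature_norm_is I J (meridian_surface f g l) a
  <->
  exists b : R,
    [/\ b <> 0,
        forall v, J v -> spherical_curvature l n v = b,
        meridian_given_by_phi I a b f
      & g_given_by_f I f g].
Proof.
have [oI iI [u0 Iu0]] := hI; have [oJ iJ _] := hJ.
have cmcP := mean_curvature_norm_isP oI oJ hm hl hn ha.
split=> [/cmcP E|[b [_ kb phiI _]]]; last first.
  apply/cmcP => u v Iu Jv; rewrite kb//.
  exact: (given_by_phi_meridianP oI hm iI hf ha phiI Iu).
have [v0 [Jv0 k0]] := hkappa; exists (spherical_curvature l n v0).
have k2 v : J v ->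
    spherical_curvature l n v ^+ 2 = spherical_curvature l n v0 ^+ 2.
  by move=> Jv; have := E u0 v Iu0 Jv; rewrite -(E u0 v0 Iu0 Jv0) => /addIr.
split=> //.
- have [v Jv||s ks] := @interval_nonzero_sign _ J (spherical_curvature l n) iJ.
  + exact: (continuous_spherical_curvature hl hn Jv).
  + by move=> v Jv; rewrite -sqrf_eq0 k2// sqrf_eq0; apply/eqP.
  + by move=> v Jv; rewrite ks// [RHS]ks// -!sqrtr_sqr k2.
- by apply: (meridian_given_by_phiP oI hm ha) => u Iu; exact: E.
- move=> u Iu; exists (derive1 g u < 0).
  have [_ _ _ /(_ u Iu) speed] := hm.
  have -> : 1 - derive1 f u ^+ 2 = derive1 g u ^+ 2.
    by rewrite -speed addrC addKr.
  by rewrite sqrtr_sqr; exact: numEsign.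
Qed.
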